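(* Let $c,d\ge 1$ be integers and $\alpha\in\mathbb{R}$. The $J_\alpha$-set $\{J_\alpha(0),\dots,J_\alpha(d-1)\}\subset\mathbb{Z}_c$ (up to translation) does not characterize the pair $\pm\alpha$: there are infinitely many $\alpha'\in\mathbb{R}$ that give the same sequence, i.e. such that $J_{\alpha'}(k)=J_\alpha(k)$ for all $k=0,\dots,d-1$.
   Context: $\mathbb{Z}_c=\mathbb{Z}/c\mathbb{Z}$ is the cyclic group with $c$ elements. For $\alpha\in\mathbb{R}$ and an integer $k$, $J_\alpha(k)=\lfloor k\alpha\rfloor \pmod c\in\mathbb{Z}_c$, where $\lfloor\cdot\rfloor$ is the floor function. *)

(* Defs.v *)
From HB Require Import structures.
From mathcomp Require Import all_boot all_order all_algebra.
From mathcomp Require Import all_classical all_reals.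
Set Implicit Arguments.
Unset Strict Implicit.
Unset Printing Implicit Defensive.
Import Order.TTheory GRing.Theory Num.Theory.
Local Open Scope classical_set_scope.
Local Open Scope ring_scope.

(* Z/cZ for every c >= 1.  The library's 'Z_c is Z/2Z when c = 1, whereas
   'I_n.+1 is the additive group Z/(n+1)Z for every n, including n = 0. *)
Definition Zmod (c : nat) : zmodType := 'I_c.-1.+1.

(* (m %% c)%Z is the representative of m in [0, c), also for m < 0. *)
Definition zres (c : nat) (m : int) : Zmod c := inZp `|(m %% c%:Z)%Z|%N.

Definition J (R : realType) (c : nat) (alpha : R) (k : int) : Zmod c :=
  zres c (Num.floor (k%:~R * alpha)).

Definition Jset (R : realType) (c d : nat) (alpha : R) : set (Zmod c) :=
  [set J c alpha k%:Z | k in [set k : nat | (k < d)%N]].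
Arguments Jset {R} c d alpha _.

Definition translate_of (G : zmodType) (A B : set G) : Prop :=
  exists t : G, B = [set t + x | x in A].

(* Within Z/cZ, the set {J_alpha(0), ..., J_alpha(d-1)}, known only up to
   translation, determines alpha up to sign. *)
Definition Jset_characterizes (R : realType) (c d : nat) (alpha : R) : Prop :=
  forall alpha' : R, translate_of (Jset c d alpha) (Jset c d alpha') ->
    alpha' = alpha \/ alpha' = - alpha.

(* Main.v *)
Require Import Defs.
From mathcomp Require Import all_boot all_order all_algebra.
From mathcomp Require Import all_classical all_reals.
Set Implicit Arguments.
Unset Strict Implicit.
Unset Printing Implicit Defensive.
Import Order.TTheory GRing.Theory Num.Theory.
Local Open Scope classical_set_scope.
Local Open Scope ring_scope.

(** The floor function is constant just to the right of every point, so for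
    each natural [k] the integer [floor (k * alpha')] does not change when
    [alpha'] increases slightly from [alpha].  A finite sequence involves only
    finitely many [k], hence one interval [alpha <= alpha' < alpha + e] with
    [e > 0] works for all of them ([floor_mulrn_right_constant]), and such an
    interval is infinite ([infinite_itvco]).  The floors agree there before any
    reduction modulo [c], so these coincidences are not merely the obvious ones
    at the points [alpha + m * c] with [m] an integer.  Equal sequences have
    equal J-sets; if the J-set characterized [alpha] up to sign, the interval
    would be contained in the pair of [alpha] and [- alpha]. *)

(** Only the upper bounds [k * alpha' < floor (k * alpha) + 1] restrict
    [alpha'], since [k >= 0] makes the lower bounds automatic to the right of
    [alpha]; this is why a right neighbourhood works and a two-sided one may
    not. *)
Lemma floor_mulrn_right_constant (R : realType) (d : nat) (alpha : R) :
  exists2 e : R, 0 < e & forall alpha' : R, alpha <= alpha' < alpha + e ->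
    forall k : nat, (k < d)%N ->
      Num.floor (k%:R * alpha') = Num.floor (k%:R * alpha).
Proof.
elim: d => [|d [e e0 floorE]]; first by exists 1.
set gap := (Num.floor (d%:R * alpha) + 1)%:~R - d%:R * alpha.
have gap0 : 0 < gap by rewrite subr_gt0 floorD1_gt.
(* Dividing by d + 1 instead of the slope d avoids the slope 0. *)
exists (Num.min e (gap / d.+1%:R)); first by rewrite lt_min e0 divr_gt0.
move=> alpha' /andP[le_alpha].
rewrite -ltrBlDl lt_min => /andP[lt_e lt_gap] k.
rewrite ltnS leq_eqVlt => /predU1P[->|]; last first.
  by apply: floorE; rewrite le_alpha -ltrBlDl.
have [floor_le_dalpha _] := andP (floor_itv (d%:R * alpha)).
apply: floor_def; apply/andP; split.
  by apply: le_trans floor_le_dalpha _; rewrite ler_wpM2l.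
rewrite ltr_pdivlMr ?ltr0Sn// in lt_gap.
have : d%:R * (alpha' - alpha) < gap.
  apply: le_lt_trans lt_gap.
  by rewrite mulrC ler_wpM2l ?subr_ge0// ler_nat.
by rewrite /gap mulrBr ltrBlDr subrK.
Qed.

Lemma infinite_itvco (R : realType) (a b : R) :
  a < b -> infinite_set [set x : R | a <= x < b].
Proof.
move=> lt_ab itv_fin; pose f (n : nat) := a + (b - a) / n.+2%:R.
have f_itv n : a <= f n < b.
  have ba0 : 0 < b - a by rewrite subr_gt0.
  rewrite lerDl divr_ge0 ?(ltW ba0)//=.
  rewrite /f -ltrBrDl ltr_pdivrMr ?ltr0Sn//.
  by rewrite ltr_pMr// ltr1n.
have f_inj : injective f.
  move=> m n /addrI/mulfI.
  rewrite subr_eq0 gt_eqF// => /(_ isT)/invr_inj/eqP.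
  by rewrite eqr_nat => /eqP[].
apply: infinite_nat.
have := finite_preimage (in2W f_inj) itv_fin.
by apply: sub_finite_set => n _; apply: f_itv.
Qed.

Theorem theorem6 (R : realType) (c d : nat) (hc : (1 <= c)%N) (hd : (1 <= d)%N)
    (alpha : R) :
  ~ Jset_characterizes c d alpha /\
  infinite_set [set alpha' : R |
    forall k : nat, (k < d)%N -> J c alpha' k%:Z = J c alpha k%:Z].
Proof.
set S := [set alpha' : R | _].
have S_inf : infinite_set S.
  have [e e0 floorE] := floor_mulrn_right_constant d alpha.
  have lt_alpha : alpha < alpha + e by rewrite ltrDl.
  apply: sub_infinite_set (infinite_itvco lt_alpha) => alpha' /floorE floorE' k kd.
  by rewrite /J -!pmulrn floorE'.
split=> // charJ; apply: S_inf.
apply: sub_finite_set (finite_set2 alpha (- alpha)) => alpha' JE.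
apply: charJ; exists 0.
have -> : Jset c d alpha' = Jset c d alpha by apply: eq_imagel => k /JE.
by rewrite (eq_imagel (f' := id)) ?image_id// => x _; rewrite add0r.
Qed.
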